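(* Let $G$ be a finitely generated group with undecidable domino problem. Then every Berger property of $G$-SFTs is undecidable. That is, for every Berger property $\mathscr{P}$ of $G$-SFTs, the set of presentations $\{(A,\mathcal{F}) \mid X_{(A,\mathcal{F})}\text{ satisfies }\mathscr{P}\}$ is not decidable.
   Context: Let $G$ be a finitely generated group and fix a finite symmetric generating set $S$ of $G$. For a word $w\in S^{*}$, $\underline{w}\in G$ denotes the corresponding group element. Subshifts. For a finite alphabet $A$, $A^G=\{x\colon G\to A\}$ carries the prodiscrete topology and the shift action $(gx)(h)=x(g^{-1}h)$. A subshift is a closed shift-invariant subset of $A^G$; the empty set is allowed. A morphism of subshifts $X\subset A^G$, $Y\subset B^G$ is a continuous map $X\to Y$ commuting with the shift action; it is a conjugacy if bijective, and a factor map if surjective (then $X$ factors onto $Y$). SFT presentations. A pattern presentation is a function $p\colon W\to A$ with $W\subset S^{*}$ finite and $A\subset\mathbb{N}$ a finite alphabet. It appears in $x\in A^G$ at $g\in G$ when $x(g\underline{w})=p(w)$ for every $w\in W$. An SFT presentation is a pair $(A,\mathcal{F})$ with $A\subset\mathbb{N}$ a finite alphabet and $\mathcal{F}$ a finite set of pattern presentations $p\colon W\to A$. It determines the subshift $X_{(A,\mathcal{F})}\subset A^G$ of all configurations in which no element of $\mathcal{F}$ appears (at any $g\in G$). Subshifts of this form are called $G$-SFTs (subshifts of finite type); the empty subshift is a $G$-SFT. The domino problem of $G$ is the set $\operatorname{DP}(G)$ of all SFT presentations $(A,\mathcal{F})$ such that $X_{(A,\mathcal{F})}=\emptyset$; $G$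 has undecidable domino problem if this set is not decidable. A dynamical property of $G$-SFTs is a property of $G$-SFTs (with a yes/no value also assigned to the empty subshift) that is invariant under conjugacy. A dynamical property $\mathscr{P}$ of $G$-SFTs is called a Berger property if there are two $G$-SFTs $X_{-}$ and $X_{+}$ such that: (1) $X_{+}$ satisfies $\mathscr{P}$; (2) every $G$-SFT that factors onto $X_{-}$ fails to satisfy $\mathscr{P}$; (3) there is a morphism from $X_{+}$ to $X_{-}$. The subshift $X_{+}$ is allowed to be empty. *)

(* Defs.v *)
From mathcomp Require Import all_boot.
From mathcomp Require Import boolp classical_sets functions topology.

Set Implicit Arguments.
Unset Strict Implicit.
Unset Printing Implicit Defensive.

Local Open Scope classical_set_scope.

(* Programs for the partial (mu-)recursive functions.  Arities are not tracked
   in the type; instead, a missing argument is read as 0. *)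
Inductive recfun : Type :=
| Zero
| Succ
| Proj of nat
| Comp of recfun & seq recfun
| Prec of recfun & recfun
| Mu of recfun.

(* [rec_eval f v y]: the program [f], run on the arguments [v], halts with
   output [y].  The recursion variable of [Prec] and the search variable of
   [Mu] are the first arguments. *)
Inductive rec_eval : recfun -> seq nat -> nat -> Prop :=
| eval_Zero v : rec_eval Zero v 0
| eval_Succ v : rec_eval Succ v (head 0 v).+1
| eval_Proj i v : rec_eval (Proj i) v (nth 0 v i)
| eval_Comp f gs v us y :
    rec_evals gs v us -> rec_eval f us y -> rec_eval (Comp f gs) v y
| eval_Prec0 f g v y : rec_eval f v y -> rec_eval (Prec f g) (0 :: v) y
| eval_PrecS f g n v r y :
    rec_eval (Prec f g) (n :: v) r -> rec_eval g [:: n, r & v] y ->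
    rec_eval (Prec f g) (n.+1 :: v) y
| eval_Mu f v n (r : nat -> nat) :
    (forall m, m < n -> rec_eval f (m :: v) (r m).+1) ->
    rec_eval f (n :: v) 0 ->
    rec_eval (Mu f) v n
with rec_evals : seq recfun -> seq nat -> seq nat -> Prop :=
| evals_nil v : rec_evals [::] v [::]
| evals_cons g gs v u us :
    rec_eval g v u -> rec_evals gs v us -> rec_evals (g :: gs) v (u :: us).

(* [D] is a decidable subset of the type [T] of instances, instances being
   given to programs through the encoding [code]. *)
Definition decidable_set (T : Type) (code : T -> nat) (D : set T) : Prop :=
  exists f : recfun, forall t : T,
    (D t -> rec_eval f [:: code t] 1) /\ (~ D t -> rec_eval f [:: code t] 0).

(* The generating set is listed without repetition as [s 0, ..., s (k - 1)];
   words over it are sequences of indices. *)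
Definition word (k : nat) : Type := seq 'I_k.

Definition word_val (G : groupType) (k : nat) (s : 'I_k -> G) (w : word k) : G :=
  (\big[*%g/1]_(i <- w) s i)%g.

Definition symmetric_generating (G : groupType) (k : nat) (s : 'I_k -> G) : Prop :=
  [/\ injective s,
      (forall i, exists j, s j = (s i)^-1)%g
    & forall g : G, exists w : word k, word_val s w = g].

(* All alphabets are finite subsets of [nat], so the full shifts A^G are
   subspaces of the product nat^G of discrete spaces. *)
Notation config G := {ptws G -> nat}.

Definition shift (G : groupType) (g : G) (x : config G) : config G :=
  fun h => x (g^-1 * h)%g.

(* Only the restriction of [phi] to [X] matters. *)
Definition morphism (G : groupType) (X Y : set (config G))
    (phi : config G -> config G) : Prop :=
  [/\ set_fun X Y phi,
      {within X, continuous phi}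
    & forall g x, X x -> phi (shift g x) = shift g (phi x)].

Definition conjugate (G : groupType) (X Y : set (config G)) : Prop :=
  exists phi, morphism X Y phi /\ set_bij X Y phi.

Definition factors_onto (G : groupType) (X Y : set (config G)) : Prop :=
  exists phi, morphism X Y phi /\ set_surj X Y phi.

(* The graph of a function from a finite set of words to [nat]. *)
Definition pattern (k : nat) : Type := seq (word k * nat).

(* Finite sets are given by lists of their elements. *)
Record presentation (k : nat) := Presentation {
  alphabet : seq nat;
  forbidden : seq (pattern k);
  presentationP :
    all (fun p : pattern k => uniq (unzip1 p) && all [in alphabet] (unzip2 p))
      forbidden }.

Definition code_word (k : nat) (w : word k) : nat :=
  CodeSeq.code [seq val i | i <- w].

Definition code_pattern (k : nat) (p : pattern k) : nat :=
  CodeSeq.code [seq CodeSeq.code [:: code_word wa.1; wa.2] | wa <- p].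

Definition code_presentation (k : nat) (P : presentation k) : nat :=
  CodeSeq.code [:: CodeSeq.code (alphabet P);
                   CodeSeq.code [seq code_pattern p | p <- forbidden P]].

Lemma code_presentation_inj k : injective (@code_presentation k).
Proof.
have cI := can_inj CodeSeq.codeK.
have wI : injective (@code_word k) by move=> u v /cI /(inj_map val_inj).
have pI : injective (@code_pattern k).
  move=> p q /cI; apply: inj_map => -[w a] [w' a'] /cI [] /wI -> ->.
  by [].
move=> [A F PF] [B E PE] /cI [] /cI /= eAB /cI /(inj_map pI) eFE.
by subst B E; congr Presentation; apply: bool_irrelevance.
Qed.

Section SFT.

Variables (G : groupType) (k : nat) (s : 'I_k -> G).

Definition appears (p : pattern k) (x : config G) (g : G) : Prop :=
  forall wa, wa \in p -> x (g * word_val s wa.1)%g = wa.2.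

Definition subshift_of (P : presentation k) : set (config G) :=
  [set x | (forall g, x g \in alphabet P) /\
           (forall p, p \in forbidden P -> forall g, ~ appears p x g)].

Definition is_SFT (X : set (config G)) : Prop :=
  exists P : presentation k, X = subshift_of P.

Definition domino_problem : set (presentation k) :=
  [set P | subshift_of P = set0].

(* A property of G-SFTs is a predicate on sets of configurations of which only
   the values on G-SFTs are relevant. *)
Definition dynamical_property (Pr : set (config G) -> Prop) : Prop :=
  forall X Y, is_SFT X -> is_SFT Y -> conjugate X Y -> (Pr X <-> Pr Y).

Definition Berger_property (Pr : set (config G) -> Prop) : Prop :=
  dynamical_property Pr /\
  exists Xminus Xplus : set (config G),
    [/\ is_SFT Xminus, is_SFT Xplus, Pr Xplus,
        (forall X, is_SFT X -> factors_onto X Xminus -> ~ Pr X)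
      & exists phi, morphism Xplus Xminus phi].

End SFT.

(* Main.v *)
Require Import Defs.
From mathcomp Require Import all_boot.
From mathcomp Require Import boolp classical_sets functions topology.

Set Implicit Arguments.
Unset Strict Implicit.
Unset Printing Implicit Defensive.

(** The domino problem of [G] reduces to the decision problem of [Pr].  Let [N]
and [M] present the subshifts X+ and X- of the Berger property.  To a
presentation [P] of a subshift Z associate a presentation of the disjoint union
of X+ with the product X- x Z.

If Z is empty then so is the product, the union is conjugate to X+
([union_empty_conjugate]) and it satisfies [Pr].  If Z contains some z, then the
projection of X- x Z to X- is onto, every y in X- being the image of (y, z);
glued with the given morphism from X+ to X- ([union_copair]) it becomes a factor
map from the union onto X-, so that [Pr] fails.  A program deciding [Pr],
composed with a program that computes the presentation of the union from [P],
would therefore decide whether Z is empty.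

The dynamical part is the description of the configurations of the two
constructions, [subshift_product] and [subshift_union].  Letters of the product
are coded pairs, and a forbidden pattern on one factor is replaced by all its
lifts to pairs.  Letters of the union carry a tag 0 or 1, and forbidding
neighbours with different tags makes the tag constant because the generators
reach every element of [G].

The computability part is that these presentations are computed from the
number coding [P].  The code of [n :: s] is the product of [2 ^ n] and
[(code s).*2.+1], so that heads and tails of coded lists are obtained by parity
tests and halvings, and primitive recursion on the length gives folds over coded
lists ([computable_foldr]).  All the lists above are built by folds. *)

(** * Programs for arithmetic and coded lists *)

Lemma eval_Proj_nth i v y : nth 0 v i = y -> rec_eval (Proj i) v y.
Proof. by move<-; apply: eval_Proj. Qed.

Lemma eval_Comp1 f g v u y :
  rec_eval g v u -> rec_eval f [:: u] y -> rec_eval (Comp f [:: g]) v y.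
Proof.
by move=> gu; apply: eval_Comp; apply: evals_cons gu _; apply: evals_nil.
Qed.

Lemma eval_Comp2 f g1 g2 v u1 u2 y :
  rec_eval g1 v u1 -> rec_eval g2 v u2 -> rec_eval f [:: u1; u2] y ->
  rec_eval (Comp f [:: g1; g2]) v y.
Proof.
move=> gu1 gu2; apply: eval_Comp; apply: evals_cons gu1 _.
by apply: evals_cons gu2 _; apply: evals_nil.
Qed.

Lemma eval_Comp3 f g1 g2 g3 v u1 u2 u3 y :
  rec_eval g1 v u1 -> rec_eval g2 v u2 -> rec_eval g3 v u3 ->
  rec_eval f [:: u1; u2; u3] y -> rec_eval (Comp f [:: g1; g2; g3]) v y.
Proof.
move=> gu1 gu2 gu3; apply: eval_Comp; apply: evals_cons gu1 _.
by apply: evals_cons gu2 _; apply: evals_cons gu3 _; apply: evals_nil.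
Qed.

(** Halting is required of [g] only on the values [R m] that the recursion goes
through: programs computing with coded lists may diverge on other numbers. *)
Lemma eval_Prec f g v n (R : nat -> nat) :
    rec_eval f v (R 0) ->
    (forall m, m < n -> rec_eval g [:: m, R m & v] (R m.+1)) ->
  rec_eval (Prec f g) (n :: v) (R n).
Proof.
move=> fR0; elim: n => [|n IHn] gR; first exact: eval_Prec0.
apply: eval_PrecS (gR n (leqnn _)).
by apply: IHn => m /leqW; apply: gR.
Qed.

Fixpoint const_prog n :=
  if n is n'.+1 then Comp Succ [:: const_prog n'] else Zero.

Lemma eval_const_prog n v : rec_eval (const_prog n) v n.
Proof.
elim: n => [|n IHn] /=; first exact: eval_Zero.
exact: eval_Comp1 IHn (eval_Succ _).
Qed.

Definition double_prog := Prec Zero (Comp Succ [:: Comp Succ [:: Proj 1]]).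

Lemma eval_double_prog n : rec_eval double_prog [:: n] n.*2.
Proof.
apply: eval_Prec => [|m _]; first exact: eval_Zero.
by do 2![apply: eval_Comp1; last exact: eval_Succ]; apply: eval_Proj_nth.
Qed.

Definition cons_prog :=
  Prec (Comp Succ [:: double_prog]) (Comp double_prog [:: Proj 1]).

Lemma eval_cons_prog a s :
  rec_eval cons_prog [:: a; CodeSeq.code s] (CodeSeq.code (a :: s)).
Proof.
apply: (eval_Prec (R := fun n => CodeSeq.code (n :: s))) => [|m _].
  by rewrite /= mul1n; apply: eval_Comp1 (eval_double_prog _) (eval_Succ _).
rewrite /= expnS -mulnA mul2n.
exact: eval_Comp1 (eval_Proj _ _) (eval_double_prog _).
Qed.

Definition flip_prog := Prec (const_prog 1) Zero.

Definition even_prog := Prec (const_prog 1) (Comp flip_prog [:: Proj 1]).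

Lemma eval_even_prog n : rec_eval even_prog [:: n] (~~ odd n).
Proof.
apply: (eval_Prec (R := fun n => ~~ odd n : nat)) => [|m _].
  exact: eval_const_prog.
apply: eval_Comp1 (eval_Proj _ _) _; rewrite /= negbK.
case: odd; first exact/eval_Prec0/eval_const_prog.
exact: eval_PrecS (eval_Prec0 _ (eval_const_prog 1 _)) (eval_Zero _).
Qed.

(* The recursion adds 1 to [n./2] exactly when [n] is odd; the inner [Prec] is
   the case distinction on the parity bit. *)
Definition half_prog :=
  Prec Zero
    (Comp (Prec (Comp Succ [:: Proj 0]) (Proj 2))
       [:: Comp even_prog [:: Proj 0]; Proj 1]).

Lemma eval_half_prog n : rec_eval half_prog [:: n] n./2.
Proof.
apply: eval_Prec => [|m _]; first exact: eval_Zero.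
apply: eval_Comp2 (eval_Proj _ _) _.
  exact: eval_Comp1 (eval_Proj _ _) (eval_even_prog _).
rewrite /= uphalf_half; case: odd => /=; rewrite ?add1n ?add0n.
  apply: eval_Prec0; exact: eval_Comp1 (eval_Proj _ _) (eval_Succ _).
apply: eval_PrecS; last exact: eval_Proj.
apply: eval_Prec0; exact: eval_Comp1 (eval_Proj _ _) (eval_Succ _).
Qed.

Definition iter_prog f := Prec (Proj 0) (Comp f [:: Proj 1]).

Lemma eval_iter_prog f n (R : nat -> nat) :
    (forall m, m < n -> rec_eval f [:: R m] (R m.+1)) ->
  rec_eval (iter_prog f) [:: n; R 0] (R n).
Proof.
move=> fR; apply: (eval_Prec (R := R)) => [|m lt_mn]; first exact: eval_Proj.
by apply: eval_Comp1 (fR _ lt_mn); apply: eval_Proj.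
Qed.

Definition shiftr_prog := iter_prog half_prog.

Lemma eval_shiftr_prog n c : rec_eval shiftr_prog [:: n; c] (iter n half c).
Proof.
by apply: (eval_iter_prog (R := fun n => iter n half c)) => m _;
  apply: eval_half_prog.
Qed.

Lemma iter_half_pow m n c : iter m half (2 ^ (m + n) * c) = 2 ^ n * c.
Proof.
elim: m => [|m IHm] in n *; first by [].
by rewrite iterS addSnnS IHm expnS -mulnA mul2n doubleK.
Qed.

(** The head of a nonempty list is the number of halvings of its code before
reaching an odd number. *)
Definition head_prog := Mu (Comp even_prog [:: shiftr_prog]).

Lemma eval_head_prog a s : rec_eval head_prog [:: CodeSeq.code (a :: s)] a.
Proof.
apply: (eval_Mu (r := fun=> 0)) => [m /subnKC <-|] /=.
  apply: eval_Comp1 (eval_shiftr_prog _ _) _.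
  rewrite addSnnS iter_half_pow expnS -mulnA mul2n.
  have := eval_even_prog (2 ^ (a - m.+1) * (CodeSeq.code s).*2.+1).*2.
  by rewrite odd_double.
apply: eval_Comp1 (eval_shiftr_prog _ _) _.
rewrite -[X in 2 ^ X]addn0 iter_half_pow mul1n.
by have := eval_even_prog (CodeSeq.code s).*2.+1; rewrite /= odd_double.
Qed.

(* The odd number so reached is [(code s).*2.+1], one halving away from
   [code s]. *)
Definition tail_prog :=
  Comp half_prog [:: Comp shiftr_prog [:: head_prog; Proj 0]].

Lemma eval_tail_prog a s :
  rec_eval tail_prog [:: CodeSeq.code (a :: s)] (CodeSeq.code s).
Proof.
apply: eval_Comp1.
  exact: eval_Comp2 (eval_head_prog _ _) (eval_Proj _ _) (eval_shiftr_prog _ _).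
rewrite /= -[X in 2 ^ X]addn0 iter_half_pow mul1n.
rewrite -[X in rec_eval _ _ X](uphalf_double (CodeSeq.code s)).
exact: eval_half_prog.
Qed.

Definition drop_prog := iter_prog tail_prog.

Lemma eval_drop_prog n s : n <= size s ->
  rec_eval drop_prog [:: n; CodeSeq.code s] (CodeSeq.code (drop n s)).
Proof.
move=> le_ns; rewrite -{1}(drop0 s).
apply: (eval_iter_prog (R := fun n => CodeSeq.code (drop n s))) => m lt_mn.
by rewrite (drop_nth 0 (leq_trans lt_mn le_ns)); apply: eval_tail_prog.
Qed.

(* The empty list is the only one with code 0. *)
Definition size_prog := Mu drop_prog.

Lemma eval_size_prog s : rec_eval size_prog [:: CodeSeq.code s] (size s).
Proof.
apply: (eval_Mu (r := fun m => (CodeSeq.code (drop m s)).-1)) => [m lt_ms|].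
  rewrite prednK; first exact/eval_drop_prog/ltnW.
  by rewrite (drop_nth 0 lt_ms) /= muln_gt0 expn_gt0.
by have := eval_drop_prog (leqnn (size s)); rewrite drop_size.
Qed.

Definition pred_prog := Prec Zero (Proj 0).

Definition sub_prog := Prec (Proj 0) (Comp pred_prog [:: Proj 1]).

Lemma eval_sub_prog m n : rec_eval sub_prog [:: n; m] (m - n).
Proof.
apply: (eval_Prec (R := fun n => m - n)) => [|p _].
  by rewrite subn0; apply: eval_Proj.
apply: eval_Comp1 (eval_Proj _ _) _; rewrite subnS.
apply: eval_Prec => [|q _]; first exact: eval_Zero.
exact: eval_Proj.
Qed.

Definition pair_prog f g := Comp cons_prog [:: f; Comp cons_prog [:: g; Zero]].

Lemma eval_pair_prog f g v a b : rec_eval f v a -> rec_eval g v b ->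
  rec_eval (pair_prog f g) v (CodeSeq.code [:: a; b]).
Proof.
move=> fa gb; apply: eval_Comp2 fa _ (eval_cons_prog _ _).
exact: eval_Comp2 gb (eval_Zero _) (eval_cons_prog b [::]).
Qed.

(** * Computable functions between encoded types *)

Class encoding (T : Type) := encode : T -> nat.

#[local] Instance encoding_nat : encoding nat := id.
#[local] Instance encoding_ord n : encoding 'I_n := val.
#[local] Instance encoding_pair (T U : Type)
    {eT : encoding T} {eU : encoding U} :
  encoding (T * U) := fun p => CodeSeq.code [:: encode p.1; encode p.2].
#[local] Instance encoding_seq (T : Type) {eT : encoding T} :
  encoding (seq T) := fun s => CodeSeq.code [seq encode x | x <- s].
#[local] Instance encoding_presentation k : encoding (presentation k) :=
  @code_presentation k.

(** Programs receive a single number.  A function of several variables, or an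
expression in a context of variables, has a product type [E] as its domain. *)
Definition computable (T U : Type) {eT : encoding T} {eU : encoding U}
    (F : T -> U) : Prop :=
  exists f, forall t, rec_eval f [:: encode t] (encode (F t)).

Lemma eq_computable {E T : Type} {eE : encoding E} {eT : encoding T}
    (F G : E -> T) :
  F =1 G -> computable F -> computable G.
Proof. by move=> eFG [f fF]; exists f => e; rewrite -eFG. Qed.

Section Computable.

Context {E T U : Type}.
Context {eE : encoding E} {eT : encoding T} {eU : encoding U}.

Lemma computable_id : computable (fun e : E => e).
Proof. by exists (Proj 0) => e; apply: eval_Proj. Qed.

Lemma computable_const (c : T) : computable (fun _ : E => c).
Proof. by exists (const_prog (encode c)) => e; apply: eval_const_prog. Qed.

Lemma computable_comp (F : T -> U) (G : E -> T) :
  computable F -> computable G -> computable (fun e => F (G e)).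
Proof.
by move=> [f fF] [g gG]; exists (Comp f [:: g]) => e; apply: eval_Comp1.
Qed.

Lemma computable_pair (F : E -> T) (G : E -> U) :
  computable F -> computable G -> computable (fun e => (F e, G e)).
Proof.
by move=> [f fF] [g gG]; exists (pair_prog f g) => e; apply: eval_pair_prog.
Qed.

Lemma computable_fst (F : E -> T * U) :
  computable F -> computable (fun e => (F e).1).
Proof.
by move=> [f fF]; exists (Comp head_prog [:: f]) => e;
  apply: eval_Comp1 (fF e) (eval_head_prog _ _).
Qed.

Lemma computable_snd (F : E -> T * U) :
  computable F -> computable (fun e => (F e).2).
Proof.
move=> [f fF]; exists (Comp head_prog [:: Comp tail_prog [:: f]]) => e.
apply: eval_Comp1 (eval_head_prog _ _).
exact: eval_Comp1 (fF e) (eval_tail_prog _ _).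
Qed.

Lemma computable_cons (F : E -> T) (G : E -> seq T) :
  computable F -> computable G -> computable (fun e => F e :: G e).
Proof.
move=> [f fF] [g gG]; exists (Comp cons_prog [:: f; g]) => e.
exact: eval_Comp2 (fF e) (gG e) (eval_cons_prog _ _).
Qed.

(** Recursion over lists, in a context [E].  Stage [n] of a primitive recursion
processes the suffix of length [n], so the loop runs [size (L e)] times; on this
range the suffix to be split is nonempty and [B] is run on genuine encodings
only. *)
Lemma computable_foldr (B : E -> T -> U -> U) (A : E -> U) (L : E -> seq T) :
    computable (fun etu : E * (T * U) => B etu.1 etu.2.1 etu.2.2) ->
    computable A -> computable L ->
  computable (fun e => foldr (B e) (A e) (L e)).
Proof.
move=> [b bB] [a aA] [l lL].
(* The arguments of [suffix] and [step] are the stage, the result so far, the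
   coded list and the context. *)
pose suffix := Comp drop_prog
  [:: Comp sub_prog [:: Comp Succ [:: Proj 0]; Comp size_prog [:: Proj 2]];
      Proj 2].
pose step := Comp b
  [:: pair_prog (Proj 3) (pair_prog (Comp head_prog [:: suffix]) (Proj 1))].
exists (Comp (Prec (Comp a [:: Proj 1]) step)
          [:: Comp size_prog [:: l]; l; Proj 0]) => e.
apply: eval_Comp3 (lL e) (eval_Proj _ _) _.
  exact: eval_Comp1 (lL e) (eval_size_prog _).
rewrite size_map /=; set s := L e.
pose R n := @encode _ eU (foldr (B e) (A e) (drop (size s - n) s)).
have -> : encode (foldr (B e) (A e) s) = R (size s) by rewrite /R subnn drop0.
apply: (eval_Prec (R := R)) => [|n lt_ns].
  by rewrite /R subn0 drop_size; apply: eval_Comp1 (aA e); apply: eval_Proj.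
have [x defs] : exists x, drop (size s - n.+1) s = x :: drop (size s - n) s.
  have x0 : T by case: (s) lt_ns.
  exists (nth x0 s (size s - n.+1)).
  by rewrite (drop_nth x0) subnSK // leq_subr.
have suffix_eval : rec_eval suffix [:: n; R n; encode s; encode e]
    (CodeSeq.code (encode x :: map encode (drop (size s - n) s))).
  apply: eval_Comp2 (eval_Proj _ _) _.
    apply: eval_Comp2 (eval_sub_prog _ _).
      exact: eval_Comp1 (eval_Proj _ _) (eval_Succ _).
    by apply: eval_Comp1 (eval_size_prog _); apply: eval_Proj.
  rewrite size_map -map_cons -defs map_drop.
  by apply: eval_drop_prog; rewrite size_map leq_subr.
rewrite {2}/R defs /=.
apply: eval_Comp1 (bB (e, (x, foldr (B e) (A e) (drop (size s - n) s)))).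
apply: eval_pair_prog; first exact: eval_Proj.
apply: eval_pair_prog; last exact: eval_Proj.
exact: eval_Comp1 suffix_eval (eval_head_prog _ _).
Qed.

End Computable.

(* Variables of a context are iterated projections. *)
Ltac computable_var :=
  cbv beta; lazymatch goal with
  | |- computable (fun e => fst _) => apply: computable_fst; computable_var
  | |- computable (fun e => snd _) => apply: computable_snd; computable_var
  | |- _ => first [exact: computable_id | exact: computable_const
                  | exact: (computable_fst computable_id)
                  | exact: (computable_snd computable_id)]
  end.

Section ComputableSeq.

Context {E T U : Type} {eE : encoding E} {eT : encoding T} {eU : encoding U}.

Lemma computable_if_nil (A B : E -> U) (L : E -> seq T) :
    computable A -> computable B -> computable L ->
  computable (fun e => if L e is [::] then A e else B e).
Proof.
move=> cA cB cL.
apply: (@eq_computable _ _ _ _ (fun e => foldr (fun _ _ => B e) (A e) (L e))).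
  by move=> e; case: (L e).
apply: (computable_foldr (B := fun e _ _ => B e)) cA cL.
exact: computable_comp cB (computable_fst computable_id).
Qed.

Lemma computable_cat (F G : E -> seq T) :
  computable F -> computable G -> computable (fun e => F e ++ G e).
Proof.
move=> cF cG.
apply: (@eq_computable _ _ _ _ (fun e => foldr cons (G e) (F e))).
  by move=> e; elim: (F e) => //= ? ? ->.
apply: (computable_foldr (B := fun _ => cons)) cG cF.
apply: computable_cons; computable_var.
Qed.

(** The variable bound by the comprehension extends the context, so that [F] may
refer to both. *)
Lemma computable_map (F : E -> T -> U) (L : E -> seq T) :
    computable (fun et : E * T => F et.1 et.2) -> computable L ->
  computable (fun e => [seq F e x | x <- L e]).
Proof.
move=> cF cL.
have cnil : computable (fun _ : E => [::] : seq U) by exact: computable_const.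
apply: (computable_foldr (B := fun e x => cons (F e x))) cnil cL.
apply: computable_cons; last computable_var.
apply: (computable_comp cF
  (G := fun etu : E * (T * seq U) => (etu.1, etu.2.1))).
apply: computable_pair; computable_var.
Qed.

End ComputableSeq.

Lemma computable_flatten {E T : Type} {eE : encoding E} {eT : encoding T}
    (L : E -> seq (seq T)) :
  computable L -> computable (fun e => flatten (L e)).
Proof.
move=> cL.
apply: (computable_foldr (B := fun _ => cat) _ (computable_const _)) cL.
apply: computable_cat; computable_var.
Qed.

Lemma computable_allpairs {E T U V : Type} {eE : encoding E} {eT : encoding T}
    {eU : encoding U} {eV : encoding V}
    (F : E -> T -> U -> V) (L : E -> seq T) (M : E -> seq U) :
    computable (fun etu : E * T * U => F etu.1.1 etu.1.2 etu.2) ->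
    computable L -> computable M ->
  computable (fun e => [seq F e x y | x <- L e, y <- M e]).
Proof.
move=> cF cL cM; apply: computable_flatten; apply: computable_map cL.
apply: (computable_map (F := fun et => F et.1 et.2)) => //.
exact: computable_comp cM (computable_fst computable_id).
Qed.

(** * Products and disjoint unions of presentations *)

Definition letter_pair (a b : nat) : nat := CodeSeq.code [:: a; b].
Definition letter_fst (c : nat) : nat := nth 0 (CodeSeq.decode c) 0.
Definition letter_snd (c : nat) : nat := nth 0 (CodeSeq.decode c) 1.

Lemma letter_fstK a b : letter_fst (letter_pair a b) = a.
Proof. by rewrite /letter_fst CodeSeq.codeK. Qed.

Lemma letter_sndK a b : letter_snd (letter_pair a b) = b.
Proof. by rewrite /letter_snd CodeSeq.codeK. Qed.

Lemma computable_letter_pair {E : Type} {eE : encoding E} (F G : E -> nat) :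
  computable F -> computable G ->
  computable (fun e => letter_pair (F e) (G e)).
Proof. exact: computable_pair. Qed.

Section Presentations.

Variable k : nat.
Implicit Types (A C : seq nat) (p q : pattern k) (P Q : presentation k).

Definition pattern_over A (p : pattern k) : bool :=
  uniq (unzip1 p) && all [in A] (unzip2 p).

(** All completions of [p] by a second letter from [C] at every word of its
domain; [h] combines both letters, in either order. *)
Definition pattern_lifts (h : nat -> nat -> nat) C (p : pattern k) :
    seq (pattern k) :=
  foldr (fun wa qs => [seq (wa.1, h wa.2 c) :: q | c <- C, q <- qs])
    [:: [::]] p.

Lemma pattern_lifts_over h A C D p q :
    (forall a c, a \in A -> c \in C -> h a c \in D) ->
    pattern_over A p -> q \in pattern_lifts h C p -> pattern_over D q.
Proof.
move=> hD /andP[up pA] q_p.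
suff [eq1 qD] : unzip1 q = unzip1 p /\ all [in D] (unzip2 q).
  by apply/andP; rewrite eq1.
elim: p {up} q pA q_p => [q _|[w a] p IHp q /= /andP[aA pA]].
  by rewrite inE => /eqP->.
case/allpairsP=> -[c r] /= [cC /IHp[]// eq1 rD ->] /=.
by rewrite eq1 hD.
Qed.

(** The empty pattern appears everywhere, so that tagging its letters, of which
there are none, would make it forbid the configurations with the other tag as
well.  It is replaced by the patterns with one letter of tag [t]. *)
Definition tagged_patterns t A (p : pattern k) : seq (pattern k) :=
  if p is [::] then [seq [:: ([::], letter_pair t a)] | a <- A]
  else [:: [seq (wa.1, letter_pair t wa.2) | wa <- p]].

Lemma tagged_patterns_over t A D p q :
    (forall a, a \in A -> letter_pair t a \in D) ->
    pattern_over A p -> q \in tagged_patterns t A p -> pattern_over D q.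
Proof.
move=> tD; case: p => [_ /mapP[a aA ->]|wa p].
  by rewrite /pattern_over /= tD.
rewrite /tagged_patterns; move: (_ :: p) => {wa} {}p /andP[up pA].
rewrite inE => /eqP->.
rewrite /pattern_over /unzip1 /unzip2 -!map_comp up all_map /=.
by move: pA; rewrite all_map; apply: sub_all => wa; apply: tD.
Qed.

Definition product_alphabet P Q : seq nat :=
  [seq letter_pair a b | a <- alphabet P, b <- alphabet Q].

Definition product_forbidden P Q : seq (pattern k) :=
  flatten [seq pattern_lifts letter_pair (alphabet Q) p | p <- forbidden P] ++
  flatten [seq pattern_lifts (fun b a => letter_pair a b) (alphabet P) q
          | q <- forbidden Q].

Lemma product_forbiddenP P Q :
  all (pattern_over (product_alphabet P Q)) (product_forbidden P Q).
Proof.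
have PP := allP (presentationP P); have PQ := allP (presentationP Q).
apply/allP=> r; rewrite mem_cat => /orP[] /flatten_mapP[p pF].
  apply: pattern_lifts_over (PP p pF) => a c aA cC.
  by apply/allpairsP; exists (a, c).
apply: pattern_lifts_over (PQ p pF) => a c aA cC.
by apply/allpairsP; exists (c, a).
Qed.

Definition product_presentation P Q : presentation k :=
  Presentation (product_forbiddenP P Q).

Definition union_alphabet P Q : seq nat :=
  [seq letter_pair 0 a | a <- alphabet P] ++
  [seq letter_pair 1 b | b <- alphabet Q].

(** One order of the tags is enough: the set of generators being symmetric, the
other one is seen from the neighbouring element. *)
Definition mixed_patterns P Q : seq (pattern k) :=
  [seq [:: ([::], letter_pair 0 ab.1); ([:: i], letter_pair 1 ab.2)]
  | i <- enum 'I_k, ab <- [seq (a, b) | a <- alphabet P, b <- alphabet Q]].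

Definition union_forbidden P Q : seq (pattern k) :=
  flatten [seq tagged_patterns 0 (alphabet P) p | p <- forbidden P] ++
  flatten [seq tagged_patterns 1 (alphabet Q) q | q <- forbidden Q] ++
  mixed_patterns P Q.

Lemma union_forbiddenP P Q :
  all (pattern_over (union_alphabet P Q)) (union_forbidden P Q).
Proof.
have PP := allP (presentationP P); have PQ := allP (presentationP Q).
have lP a : a \in alphabet P -> letter_pair 0 a \in union_alphabet P Q.
  by move=> aP; rewrite mem_cat map_f.
have lQ b : b \in alphabet Q -> letter_pair 1 b \in union_alphabet P Q.
  by move=> bQ; rewrite mem_cat orbC map_f.
apply/allP=> r; rewrite !mem_cat.
case/or3P=> [/flatten_mapP[p pF]|/flatten_mapP[p pF]|].
- exact: tagged_patterns_over (PP p pF).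
- exact: tagged_patterns_over (PQ p pF).
case/allpairsP=> -[i ab] [_ /allpairsP[[a b] [/= aP bQ ->]] ->].
by rewrite /pattern_over /= lP ?lQ.
Qed.

Definition union_presentation P Q : presentation k :=
  Presentation (union_forbiddenP P Q).

(** * Computability of the constructions *)

Section ComputablePresentations.

Context {E : Type} {eE : encoding E}.

(* Lists of numbers are coded directly in [code_presentation] and through the
   identity encoding of [nat] in [encode]. *)
Lemma encode_presentation P :
  encode P = encode (alphabet P, forbidden P).
Proof.
congr (CodeSeq.code [:: CodeSeq.code _; _]).
by rewrite -[LHS]map_id.
Qed.

Lemma computable_alphabet (F : E -> presentation k) :
  computable F -> computable (fun e => alphabet (F e)).
Proof.
move=> [f fF]; apply: (computable_fst
  (F := fun e => (alphabet (F e), forbidden (F e)))).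
by exists f => e; rewrite -encode_presentation; apply: fF.
Qed.

Lemma computable_forbidden (F : E -> presentation k) :
  computable F -> computable (fun e => forbidden (F e)).
Proof.
move=> [f fF]; apply: (computable_snd
  (F := fun e => (alphabet (F e), forbidden (F e)))).
by exists f => e; rewrite -encode_presentation; apply: fF.
Qed.

Lemma computable_presentation (F : E -> presentation k) :
    computable (fun e => alphabet (F e)) ->
    computable (fun e => forbidden (F e)) ->
  computable F.
Proof.
move=> cA cF; have [f fF] := computable_pair cA cF.
by exists f => e; rewrite encode_presentation; apply: fF.
Qed.

Lemma computable_pattern_lifts (h : nat -> nat -> nat) (C : E -> seq nat)
    (F : E -> pattern k) :
    computable (fun ab : nat * nat => h ab.1 ab.2) ->
    computable C -> computable F ->
  computable (fun e => pattern_lifts h (C e) (F e)).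
Proof.
move=> ch cC cF.
apply: (computable_foldr (B := fun e wa qs =>
  [seq (wa.1, h wa.2 c) :: q | c <- C e, q <- qs]) _ (computable_const _)) cF.
apply: computable_allpairs; last computable_var.
  apply: computable_cons; last computable_var.
  apply: computable_pair.
    computable_var.
  apply: (computable_comp ch (G := fun etu => (_, _))); apply: computable_pair; computable_var.
exact: computable_comp cC (computable_fst computable_id).
Qed.

Lemma computable_tagged_patterns t (C : E -> seq nat) (F : E -> pattern k) :
  computable C -> computable F ->
  computable (fun e => tagged_patterns t (C e) (F e)).
Proof.
move=> cC cF; apply: computable_if_nil => //.
  apply: computable_map cC; apply: computable_cons (computable_const _).
  apply: computable_pair; first computable_var.
  apply: computable_letter_pair; computable_var.
apply: computable_cons (computable_const _); apply: computable_map cF.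
apply: computable_pair; first computable_var.
apply: computable_letter_pair; computable_var.
Qed.

End ComputablePresentations.

Section ComputableConstructions.

Context {E : Type} {eE : encoding E}.

Lemma computable_product_presentation (F G : E -> presentation k) :
  computable F -> computable G ->
  computable (fun e => product_presentation (F e) (G e)).
Proof.
move=> cF cG; apply: computable_presentation.
  apply: computable_allpairs; try exact: computable_alphabet.
  apply: computable_letter_pair; computable_var.
apply: computable_cat; apply: computable_flatten; apply: computable_map;
  try exact: computable_forbidden.
  apply: computable_pattern_lifts; last computable_var.
    apply: computable_letter_pair; computable_var.
  apply: computable_alphabet.
  exact: computable_comp cG (computable_fst computable_id).
apply: computable_pattern_lifts; last computable_var.
  apply: computable_letter_pair; computable_var.
apply: computable_alphabet.
exact: computable_comp cF (computable_fst computable_id).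
Qed.

Lemma computable_union_presentation (F G : E -> presentation k) :
  computable F -> computable G ->
  computable (fun e => union_presentation (F e) (G e)).
Proof.
move=> cF cG.
have cAF := computable_alphabet cF; have cAG := computable_alphabet cG.
apply: computable_presentation.
  apply: computable_cat; [apply: computable_map cAF|apply: computable_map cAG];
    apply: computable_letter_pair (computable_const _) _;
    computable_var.
apply: computable_cat; last apply: computable_cat.
- apply: computable_flatten.
  apply: computable_map; last exact: computable_forbidden.
  apply: computable_tagged_patterns; last computable_var.
  exact: computable_comp cAF (computable_fst computable_id).
- apply: computable_flatten.
  apply: computable_map; last exact: computable_forbidden.
  apply: computable_tagged_patterns; last computable_var.
  exact: computable_comp cAG (computable_fst computable_id).
apply: computable_allpairs; first 1 last.
- exact: computable_const.
- apply: computable_allpairs => //; apply: computable_pair; computable_var.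
apply: computable_cons; last apply: computable_cons (computable_const _).
  apply: computable_pair (computable_const _) _.
  apply: computable_letter_pair (computable_const _) _.
  computable_var.
apply: computable_pair.
  apply: computable_cons (computable_const _).
  computable_var.
apply: computable_letter_pair (computable_const _) _.
computable_var.
Qed.

End ComputableConstructions.

End Presentations.

(** * Configurations of products and disjoint unions *)

Section Dynamics.

Variables (G : groupType) (k : nat) (s : 'I_k -> G).
Implicit Types (x y z : config G) (p q : pattern k) (P Q : presentation k).

Definition map_config (f : nat -> nat) (x : config G) : config G :=
  fun g => f (x g).

Definition pair_config (y z : config G) : config G :=
  fun g => letter_pair (y g) (z g).

Lemma map_fst_pair_config y z : map_config letter_fst (pair_config y z) = y.
Proof. by apply: funext => g; apply: letter_fstK. Qed.

Definition avoids (F : seq (pattern k)) x : Prop :=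
  forall p, p \in F -> forall g, ~ appears s p x g.

Lemma avoids_cat (F1 F2 : seq (pattern k)) x :
  avoids (F1 ++ F2) x <-> avoids F1 x /\ avoids F2 x.
Proof.
split=> [aF|[aF1 aF2] p].
  by split=> p pF; apply: aF; rewrite mem_cat pF ?orbT.
by rewrite mem_cat => /orP[]; [apply: aF1 | apply: aF2].
Qed.

(** The common principle of both constructions: replacing every [p] by patterns
that detect [p] in another configuration transfers the constraints. *)
Lemma avoids_flatten_map (L : pattern k -> seq (pattern k)) F x y :
    (forall p g,
       (exists2 q, q \in L p & appears s q x g) <-> appears s p y g) ->
  avoids (flatten [seq L p | p <- F]) x <-> avoids F y.
Proof.
move=> Lxy; split=> avF p.
  move=> pF g /Lxy[q qL]; apply: avF.
  by apply/flatten_mapP; exists p.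
by case/flatten_mapP=> q qF pL g px; apply: (avF q qF g); apply/Lxy; exists p.
Qed.

Lemma appears_cons wa p x g :
  appears s (wa :: p) x g <->
  x (g * word_val s wa.1)%g = wa.2 /\ appears s p x g.
Proof.
split=> [ap|[xwa ap] wb]; last by rewrite inE => /predU1P[->|/ap].
by split=> [|wb wbp]; apply: ap; rewrite inE ?eqxx ?wbp ?orbT.
Qed.

(** Among the completions of [p], the one that can appear in [x] is given by the
second component [z] of [x]. *)
Lemma appears_pattern_lifts (h : nat -> nat -> nat) (C : seq nat) x y z p g :
    (forall a b a' b', h a b = h a' b' -> a = a') ->
    (forall g, z g \in C) -> (forall g, x g = h (y g) (z g)) ->
  (exists2 q, q \in pattern_lifts h C p & appears s q x g) <-> appears s p y g.
Proof.
move=> h_inj zC xE; elim: p => [|[w a] p IHp] /=.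
  by split=> // _; exists [::].
rewrite appears_cons -IHp; split=> /=.
  case=> _ /allpairsP[[c q] /= [cC qp ->]] /appears_cons[/=].
  by rewrite xE => /h_inj -> qx; split=> //; exists q.
case=> yw [q qp qx].
exists ((w, h a (z (g * word_val s w)%g)) :: q).
  apply/allpairsP; exists (z (g * word_val s w)%g, q); split=> //=.
by apply/appears_cons; rewrite /= xE yw.
Qed.

Lemma subshift_product P Q x :
  subshift_of s (product_presentation P Q) x <->
  exists y z, [/\ subshift_of s P y, subshift_of s Q z & x = pair_config y z].
Proof.
have avoidsE y z : (forall g, y g \in alphabet P) ->
    (forall g, z g \in alphabet Q) ->
  avoids (product_forbidden P Q) (pair_config y z) <->
  avoids (forbidden P) y /\ avoids (forbidden Q) z.
  move=> yP zQ; rewrite avoids_cat.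
  have ->: avoids (flatten [seq pattern_lifts letter_pair (alphabet Q) p
      | p <- forbidden P]) (pair_config y z) <-> avoids (forbidden P) y.
    apply: avoids_flatten_map => p g.
    apply: appears_pattern_lifts zQ _ => // a b a' b'.
    by move/(congr1 letter_fst); rewrite !letter_fstK.
  suff ->: avoids (flatten [seq pattern_lifts (fun b a => letter_pair a b)
      (alphabet P) p | p <- forbidden Q]) (pair_config y z) <->
      avoids (forbidden Q) z by [].
  apply: avoids_flatten_map => p g.
  apply: appears_pattern_lifts yP _ => // a b a' b'.
  by move/(congr1 letter_snd); rewrite !letter_sndK.
split=> [[xA avF]|[y [z [[yP avP] [zQ avQ] ->]]]]; last first.
  split=> [g|]; last exact/avoidsE.
  by apply/allpairsP; exists (y g, z g); split=> //=.
have xP g : exists ab : nat * nat, [/\ ab.1 \in alphabet P,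
    ab.2 \in alphabet Q & x g = letter_pair ab.1 ab.2].
  by have /allpairsP := xA g.
pose y := map_config letter_fst x; pose z := map_config letter_snd x.
have xE : x = pair_config y z.
  apply: funext => g; rewrite /pair_config /y /z /map_config.
  by have [[a b] [_ _ ->]] := xP g; rewrite letter_fstK letter_sndK.
have yP g : y g \in alphabet P.
  rewrite /y /map_config; have [[a b] [aP _ ->]] := xP g.
  by rewrite letter_fstK.
have zQ g : z g \in alphabet Q.
  rewrite /z /map_config; have [[a b] [_ bQ ->]] := xP g.
  by rewrite letter_sndK.
move: (avF); rewrite {1}xE => /(avoidsE _ _ yP zQ)[avP avQ].
by exists y, z.
Qed.

Definition tag_config t : config G -> config G := map_config (letter_pair t).

Lemma untag_tag_config t y : map_config letter_snd (tag_config t y) = y.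
Proof. by apply: funext => g; apply: letter_sndK. Qed.

Lemma appears_tagged_patterns t A y p g :
    (forall g, y g \in A) ->
  (exists2 q, q \in tagged_patterns t A p & appears s q (tag_config t y) g) <->
  appears s p y g.
Proof.
move=> yA; case: p => [|wa p]; rewrite /tagged_patterns.
  split=> // _; exists [:: ([::], letter_pair t (y g))].
    exact/map_f/yA.
  apply/appears_cons; split=> //=.
  by rewrite /word_val big_nil mulg1.
move: (_ :: p) => {wa} {}p; have tagE r :
    appears s [seq (wa.1, letter_pair t wa.2) | wa <- r] (tag_config t y) g <->
    appears s r y g.
  elim: r => [|wa r IHr] //=; rewrite !appears_cons IHr /=.
  split=> [] [eq_wa rg]; split=> //.
    by move/(congr1 letter_snd): eq_wa; rewrite !letter_sndK.
  by rewrite /tag_config /map_config eq_wa.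
split=> [[_ /[!inE]/eqP-> /tagE]//|pg].
by eexists; [rewrite inE|apply/tagE].
Qed.

Lemma appears_tagged_patterns_neq t t' A y p q g :
  t != t' -> q \in tagged_patterns t A p -> ~ appears s q (tag_config t' y) g.
Proof.
move=> tt'; have letter_neq a b : letter_pair t' a <> letter_pair t b.
  move/(congr1 letter_fst); rewrite !letter_fstK => e.
  by rewrite e eqxx in tt'.
case: p => [|wa p] /=.
  by case/mapP=> a _ -> /appears_cons[] /letter_neq.
by rewrite inE => /eqP-> /appears_cons[] /letter_neq.
Qed.

Lemma avoids_tagged_patterns t A F y : (forall g, y g \in A) ->
  avoids (flatten [seq tagged_patterns t A p | p <- F]) (tag_config t y) <->
  avoids F y.
Proof.
move=> yA; apply: avoids_flatten_map => p g.
exact: appears_tagged_patterns.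
Qed.

Lemma avoids_tagged_patterns_neq t t' A F y : t != t' ->
  avoids (flatten [seq tagged_patterns t A p | p <- F]) (tag_config t' y).
Proof.
move=> tt' q /flatten_mapP[p _ qp] g.
exact: appears_tagged_patterns_neq qp.
Qed.

Lemma appears_mixed_pattern x a b i g :
  appears s [:: ([::], letter_pair 0 a); ([:: i], letter_pair 1 b)] x g <->
  x g = letter_pair 0 a /\ x (g * s i)%g = letter_pair 1 b.
Proof.
rewrite !appears_cons /word_val big_nil big_seq1 mulg1.
by split=> [[? []]|[? ?]].
Qed.

Lemma tag_config_avoids_mixed P Q t y :
  avoids (mixed_patterns P Q) (tag_config t y).
Proof.
move=> q /allpairsP[[i ab] [_ /allpairsP[[a b] [/= _ _ ->]] ->]] g.
case/appears_mixed_pattern=> /(congr1 letter_fst) + /(congr1 letter_fst).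
by rewrite !letter_fstK => ->.
Qed.

Hypothesis hs : symmetric_generating s.

(** The tag does not change along any generator, and the generators connect
every element of [G] to 1. *)
Lemma avoids_mixed_constant_tag P Q x :
    (forall g, x g \in union_alphabet P Q) -> avoids (mixed_patterns P Q) x ->
  forall g, letter_fst (x g) = letter_fst (x 1%g).
Proof.
move=> xA avx; have [_ s_inv s_gen] := hs.
have xAP g : exists a, (a \in alphabet P /\ x g = letter_pair 0 a) \/
                       (a \in alphabet Q /\ x g = letter_pair 1 a).
  have := xA g; rewrite mem_cat => /orP[] /mapP[a aA ->]; exists a.
    by left.
  by right.
have not_mixed g i a b : a \in alphabet P -> b \in alphabet Q ->
    x g = letter_pair 0 a -> x (g * s i)%g <> letter_pair 1 b.
  move=> aP bQ xg xgi.
  apply: (avx [:: ([::], letter_pair 0 a); ([:: i], letter_pair 1 b)] _ g).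
    apply/allpairsP; exists (i, (a, b)); split=> //=; first by rewrite mem_enum.
    by apply/allpairsP; exists (a, b); split.
  exact/appears_mixed_pattern.
have step g i : letter_fst (x (g * s i)%g) = letter_fst (x g).
  have [a [] [aA xg]] := xAP g; have [b [] [bA xgi]] := xAP (g * s i)%g;
    rewrite xg xgi !letter_fstK //.
    by case: (not_mixed g i a b).
  have [j sj] := s_inv i; case: (not_mixed (g * s i)%g j b a) => //.
  by rewrite sj mulgK.
move=> g; have [w <-] := s_gen g; elim/last_ind: w => [|w i IHw].
  by rewrite /word_val big_nil.
by rewrite /word_val -cats1 big_cat big_seq1 step.
Qed.

Lemma subshift_union P Q x :
  subshift_of s (union_presentation P Q) x <->
  (exists2 y, subshift_of s P y & x = tag_config 0 y) \/
  (exists2 y, subshift_of s Q y & x = tag_config 1 y).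
Proof.
have avoidsE : avoids (union_forbidden P Q) x <->
    [/\ avoids (flatten [seq tagged_patterns 0 (alphabet P) p
                        | p <- forbidden P]) x,
        avoids (flatten [seq tagged_patterns 1 (alphabet Q) p
                        | p <- forbidden Q]) x
      & avoids (mixed_patterns P Q) x].
  split=> [/avoids_cat[avP /avoids_cat[avQ avM]]|[avP avQ avM]]; first by split.
  by apply/avoids_cat; split=> //; apply/avoids_cat.
split=> [[xA /avoidsE[avP avQ avM]]|xPQ].
  have x_tag := avoids_mixed_constant_tag xA avM.
  pose y := map_config letter_snd x.
  have := xA 1%g; rewrite mem_cat => /orP[] /mapP[a0 _ x1]; [left|right].
    have yP g : y g \in alphabet P /\ x g = letter_pair 0 (y g).
      have := x_tag g; have := xA g.
      rewrite mem_cat /y /map_config x1 letter_fstK.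
      by case/orP=> /mapP[a aA ->]; rewrite letter_fstK letter_sndK.
    have xE : x = tag_config 0 y by apply: funext => g; case: (yP g).
    exists y => //; split=> [g|]; first by case: (yP g).
    have yA g : y g \in alphabet P by case: (yP g).
    by apply/(avoids_tagged_patterns 0 _ yA); rewrite -xE; apply: avP.
  have yQ g : y g \in alphabet Q /\ x g = letter_pair 1 (y g).
    have := x_tag g; have := xA g.
    rewrite mem_cat /y /map_config x1 letter_fstK.
    by case/orP=> /mapP[a aA ->]; rewrite letter_fstK letter_sndK.
  have xE : x = tag_config 1 y by apply: funext => g; case: (yQ g).
  exists y => //; split=> [g|]; first by case: (yQ g).
  have yA g : y g \in alphabet Q by case: (yQ g).
  by apply/(avoids_tagged_patterns 1 _ yA); rewrite -xE; apply: avQ.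
case: xPQ => [] [y [yA avy] x_eq];
  (split=> [g|]; last apply/avoidsE); rewrite x_eq.
- by rewrite mem_cat; apply/orP; left; apply: map_f.
- split; [exact/avoids_tagged_patterns|exact: avoids_tagged_patterns_neq|].
  exact: tag_config_avoids_mixed.
- by rewrite mem_cat; apply/orP; right; apply: map_f.
split; [exact: avoids_tagged_patterns_neq|exact/avoids_tagged_patterns|].
exact: tag_config_avoids_mixed.
Qed.

End Dynamics.

(** * Morphisms *)

Section Morphisms.

Local Open Scope classical_set_scope.

Variables (G : groupType).
Implicit Types (x y : config G) (X Y Z : set (config G)).

Lemma cvg_config (F : set_system (config G)) x : Filter F ->
  F --> x <-> forall g, F [set y | y g = x g].
Proof.
move=> FF; rewrite cvg_sup; split=> cvgF g.
  have := cvgF g; rewrite cvg_image; last first.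
    by rewrite eqEsubset; split=> n // _; exists (fun=> n).
  move=> /(_ [set x g]) [|A FA eqA]; first by rewrite nbhs_principalE.
  apply: filterS FA => y Ay /=.
  suff: [set x g] (y g) by [].
  by rewrite -eqA; exists y.
rewrite cvg_image; last by rewrite eqEsubset; split=> n // _; exists (fun=> n).
move=> A; rewrite nbhs_principalE => /principal_filterP Ax.
exists [set y : config G | A (y g)].
  by apply: filterS (cvgF g) => y /= ->.
by rewrite eqEsubset; split=> [n [y Ay <-]|n An] //; exists (fun=> n).
Qed.

Lemma nbhs_config x g : nbhs x [set y | y g = x g].
Proof. by move: g; apply/cvg_config. Qed.

(** Letters being discrete, continuity means that each letter of the image is
locally constant. *)
Lemma within_continuous_config X (phi : config G -> config G) :
  {within X, continuous phi} <->
  forall x, X x -> forall g, \forall y \near x, X y -> phi y g = phi x g.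
Proof.
rewrite subspace_continuousP; split=> cphi x Xx.
  by move=> g; move: (cphi x Xx) => /cvg_config; apply.
by apply/cvg_config => g; apply: cphi.
Qed.

Lemma map_config_continuous f x :
  map_config f @ x --> (map_config f x : config G).
Proof.
apply/cvg_config => g; apply: filterS (nbhs_config x g) => y /= yx.
by rewrite /map_config yx.
Qed.

Lemma map_config_morphism f X Y :
  set_fun X Y (map_config f) -> morphism X Y (map_config f).
Proof.
move=> fXY; split=> //; apply/within_continuous_config => x _ g.
apply: filterS (nbhs_config x g) => y /= yx _.
by rewrite /map_config yx.
Qed.

(** The letter at 1 fixes the tag of all configurations near [tag_config t y],
and removing tags is continuous, so a map continuous on [X] remains locally
constant at [g] when read through the tag. *)
Lemma near_tag_config t X (phi : config G -> config G) y g :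
    {within X, continuous phi} -> X y ->
  \forall x \near tag_config t y, forall t' z,
    x = tag_config t' z -> t' = t /\ (X z -> phi z g = phi y g).
Proof.
move=> /within_continuous_config phi_cts Xy.
have near_y : nbhs (map_config letter_snd (tag_config t y))
    [set z | X z -> phi z g = phi y g].
  by rewrite untag_tag_config; apply: phi_cts.
have near_phi : \forall x \near tag_config t y,
    X (map_config letter_snd x) -> phi (map_config letter_snd x) g = phi y g.
  exact: map_config_continuous near_y.
apply: filterS2 near_phi (nbhs_config (tag_config t y) 1%g).
move=> x /= + + t' z xE; rewrite {}xE untag_tag_config.
by move=> phi_z /(congr1 letter_fst); rewrite !letter_fstK.
Qed.

Variables (k : nat) (s : 'I_k -> G) (hs : symmetric_generating s).
Implicit Types P Q : presentation k.

(** The universal property of the disjoint union.  The two maps are glued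
according to the tag of the letter at 1, a local and shift-invariant choice on
the union. *)
Lemma union_copair P Q Z phi psi :
    morphism (subshift_of s P) Z phi -> morphism (subshift_of s Q) Z psi ->
  exists chi, [/\ morphism (subshift_of s (union_presentation P Q)) Z chi,
    forall y, chi (tag_config 0 y) = phi y &
    forall y, chi (tag_config 1 y) = psi y].
Proof.
move=> [phiZ phi_cts phi_shift] [psiZ psi_cts psi_shift].
pose chi x := if letter_fst (x 1%g) == 0 then phi (map_config letter_snd x)
              else psi (map_config letter_snd x).
have chi0 y : chi (tag_config 0 y) = phi y.
  by rewrite /chi untag_tag_config letter_fstK.
have chi1 y : chi (tag_config 1 y) = psi y.
  by rewrite /chi untag_tag_config letter_fstK.
exists chi; split=> //; split.
- by move=> _ /(subshift_union hs)[] [y yX ->]; rewrite ?chi0 ?chi1;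
    [apply: phiZ|apply: psiZ].
- apply/within_continuous_config => _ /(subshift_union hs)[] [y yX ->] g.
    apply: filterS (near_tag_config 0 g phi_cts yX) => x near_y.
    case/(subshift_union hs) => [] [z zX xE];
      have [t_eq phi_z] := near_y _ _ xE => //.
    by rewrite xE !chi0 phi_z.
  apply: filterS (near_tag_config 1 g psi_cts yX) => x near_y.
  case/(subshift_union hs) => [] [z zX xE];
    have [t_eq psi_z] := near_y _ _ xE => //.
  by rewrite xE !chi1 psi_z.
move=> g _ /(subshift_union hs)[] [y yX ->].
  by rewrite -[shift g _]/(tag_config 0 (shift g y)) !chi0 phi_shift.
by rewrite -[shift g _]/(tag_config 1 (shift g y)) !chi1 psi_shift.
Qed.

Lemma union_empty_conjugate P Q : subshift_of s Q = set0 ->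
  conjugate (subshift_of s P) (subshift_of s (union_presentation P Q)).
Proof.
move=> Q0; exists (tag_config 0).
have tagU : set_fun (subshift_of s P) (subshift_of s (union_presentation P Q))
    (tag_config 0).
  by move=> y yP; apply/(subshift_union hs); left; exists y.
split; first exact: map_config_morphism.
split=> // [y z _ _ eq_yz|_ /(subshift_union hs)[] [y yX ->]].
- by rewrite -(untag_tag_config 0 y) -(untag_tag_config 0 z); congr map_config.
- by exists y.
by rewrite Q0 in yX.
Qed.

Lemma product_fst_morphism P Q :
  morphism (subshift_of s (product_presentation P Q)) (subshift_of s P)
    (map_config letter_fst).
Proof.
apply: map_config_morphism => _ /subshift_product[y [z [yP _ ->]]].
by rewrite map_fst_pair_config.
Qed.

End Morphisms.

Theorem theorem3p6 (G : groupType) (k : nat) (s : 'I_k -> G)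
    (hs : symmetric_generating s)
    (hDP : ~ decidable_set (@code_presentation k) (domino_problem s))
    (Pr : set (config G) -> Prop) (hPr : Berger_property s Pr) :
  ~ decidable_set (@code_presentation k)
      [set P : presentation k | Pr (subshift_of s P)]%classic.
Proof.
move=> [f fPr]; apply: hDP.
case: hPr => Pr_conj [Xm [Xp [[M ->{Xm}] [N ->{Xp}] PrN PrM [phi phiNM]]]].
pose reduction P := union_presentation N (product_presentation M P).
have [r rE] : computable reduction.
  apply: computable_union_presentation (computable_const _) _.
  exact: computable_product_presentation (computable_const _) computable_id.
exists (Comp f [:: r]) => P; rewrite /domino_problem /=.
have [PrD notPrD] := fPr (reduction P); split=> [P0|Pn0].
  apply: eval_Comp1 (rE P) _; apply: PrD => /=.
  have conjU : conjugate (subshift_of s N) (subshift_of s (reduction P)).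
    apply: union_empty_conjugate => //.
    apply/seteqP; split=> // x /subshift_product[y [z [_ zP _]]].
    by rewrite P0 in zP.
  by apply/(Pr_conj _ _ _ _ conjU); [exists N|exists (reduction P)|].
apply: eval_Comp1 (rE P) _; apply: notPrD; apply: PrM.
  by exists (reduction P).
have [chi [chi_morph _ chi1]] :=
  union_copair hs phiNM (product_fst_morphism s M P).
exists chi; split=> // y yM.
have [z zP] : (subshift_of s P !=set0)%classic by apply/set0P/eqP.
exists (tag_config 1 (pair_config y z)).
  apply/(subshift_union hs); right; exists (pair_config y z) => //.
  by apply/subshift_product; exists y, z.
by rewrite chi1 map_fst_pair_config.
Qed.
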